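(* Let $p$ be an odd prime and let $r,s \geq 1$ be integers. Let $L/K$ be an extension of number fields with $[L:K]=p^{s}$ and $L \subseteq \mathbb{Q}(\zeta_{p^{r+s}})$. Then $L/K$ is Leopoldt, i.e. $\mathcal{O}_L$ is a free module over the associated order $\mathcal{A}_{L/K}$.
   Context: For an integer $n\ge 1$, $\zeta_n$ denotes a primitive $n$-th root of unity and $\mathbb{Q}(\zeta_n)$ is the $n$-th cyclotomic field. For a finite Galois extension of number fields $L/K$ with group $G$, the associated order is $\mathcal{A}_{L/K}=\{x\in K[G] : x(\mathcal{O}_L)\subseteq \mathcal{O}_L\}$, where $K[G]$ acts on $L$ in the obvious way. An extension $L/K$ of number fields with $L/\mathbb{Q}$ abelian is called Leopoldt if $\mathcal{O}_L$ is a free $\mathcal{A}_{L/K}$-module (necessarily of rank 1). *)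

(* Defs.v *)
From HB Require Import structures.
From mathcomp Require Import all_boot all_order all_algebra.
From mathcomp Require Import all_fingroup all_solvable all_field.

Set Implicit Arguments.
Unset Strict Implicit.
Unset Printing Implicit Defensive.

Import GRing.Theory.
Local Open Scope ring_scope.

(* All number fields are subfields of one ambient finite normal extension M   *)
(* of the rationals, so that 'Gal(E / K) is available.                        *)
Section Leopoldt.

Variable M : splittingFieldType rat.

Definition ring_of_integers (E : {subfield M}) (x : M) : Prop :=
  x \in E /\ integralOver (intr : int -> M) x.

Section AssociatedOrder.

Variables K E : {subfield M}.

(* The group algebra K[G], G = 'Gal(E / K), by coefficient families. Only its *)
(* additive group and its action on E enter into the definition of freeness   *)
(* of a module, so its (convolution) product is not needed.                   *)
Definition group_algebra : Type :=
  {ffun subg_of 'Gal(E / K)%G -> subvs_of K}.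

Definition ga_act (a : group_algebra) (x : M) : M :=
  \sum_(g : subg_of 'Gal(E / K)%G) vsval (a g) * (sgval g : gal_of E) x.

Definition associated_order (a : group_algebra) : Prop :=
  forall x, ring_of_integers E x -> ring_of_integers E (ga_act a x).

Definition integers_basis (n : nat) (e : 'I_n -> M) : Prop :=
  (forall i, ring_of_integers E (e i)) /\
  (forall x, ring_of_integers E x ->
     exists! a : {ffun 'I_n -> group_algebra},
       (forall i, associated_order (a i)) /\ x = \sum_i ga_act (a i) (e i)).

(* The integers of E are finitely generated over Z, so a basis of them is     *)
(* necessarily finite.                                                        *)
Definition leopoldt : Prop :=
  exists (n : nat) (e : 'I_n -> M), integers_basis e.

End AssociatedOrder.

End Leopoldt.

(* Main.v *)
Require Import Defs.
From HB Require Import structures.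
From mathcomp Require Import all_boot all_order all_algebra.
From mathcomp Require Import all_fingroup all_solvable all_field.
From mathcomp Require Import ring zify.

(* Let w be a primitive p-th root of 1.  Since [K(w) : K] < p, the extensions
   L and K(w) of K are linearly disjoint.  Coordinates on a basis of the
   integers of L(w) over the associated order of L(w) / K(w) are unique; so, if
   the basis lies in L, the coordinates of an integer of L are fixed by
   Gal(L(w) / L), hence lie in K, and the basis is also one for L / K.

   Now L(w) = Q(z) and K(w) = Q(z^S) for a root of unity z of order q S, where
   q and S = p^s are powers of p, and the integers of Q(z) are Z[z].  The Galois
   group G of Q(z) / Q(z^S) multiplies exponents by the 1 + q t; call two
   exponents equivalent when they are in the same orbit modulo S.  The span of
   the powers of z over a class is cut out by an idempotent of the group algebra
   which preserves Z[z], and two powers of the same class differ by an element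
   of G and a power of z^S.  Hence the sum x of one power of z per class
   generates the integers of Q(z) over their associated order, and freely so.

   An element of Gal(L(w) / L) that stabilizes a class other than that of 0
   fixes w, so it is trivial.  Therefore the exponents in x can be chosen stable
   under Gal(L(w) / L), and then x is in L. *)

Set Implicit Arguments.
Unset Strict Implicit.
Unset Printing Implicit Defensive.

Import GRing.Theory Num.Theory.
Local Open Scope ring_scope.

Local Notation integral := (integralOver (intr : int -> _)).

(** * Integers of number fields *)

Section NumberField.

Variable M : fieldExtType rat.

Lemma fieldExt_rat_natr_eq0 n : (n%:R == 0 :> M) = (n == 0).
Proof. by rewrite -(rmorph_nat (in_alg M)) fmorph_eq0 pnatr_eq0. Qed.

Lemma fieldExt_rat_intr_eq0 (c : int) : (c%:~R == 0 :> M) = (c == 0).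
Proof. by rewrite -(rmorph_int (in_alg M)) fmorph_eq0 intr_eq0. Qed.

Lemma fieldExt_rat_intr_inj : injective (intr : int -> M).
Proof.
move=> a b /eqP; rewrite -subr_eq0 -intrB fieldExt_rat_intr_eq0 subr_eq0.
by move/eqP.
Qed.

Lemma map_poly_in_alg_intr (q : {poly int}) :
  map_poly (in_alg M) (map_poly intr q) = map_poly intr q.
Proof.
by rewrite -map_poly_comp; apply: eq_map_poly => c /=;
  apply: (rmorph_int (in_alg M)).
Qed.

Lemma integral_sum (I : Type) (r : seq I) (P : pred I) (f : I -> M) :
  (forall i, P i -> integral (f i)) -> integral (\sum_(i <- r | P i) f i).
Proof.
move=> intf; elim/big_ind: _ => //; [exact: integral0 | exact: integral_add].
Qed.

Lemma integral_exp (x : M) n : integral x -> integral (x ^+ n).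
Proof.
move=> intx; elim: n => [|n IHn]; first exact: integral1.
by rewrite exprS; apply: integral_mul.
Qed.

Lemma integral_unity_root (x : M) n : (0 < n)%N -> x ^+ n = 1 -> integral x.
Proof.
move=> n_gt0 xn1; exists ('X^n - 1); first exact: monicXnsubC.
by apply/rootP; rewrite rmorphB rmorph1 /= map_polyXn !hornerE xn1 subrr.
Qed.

Lemma integral_prim_root (z : M) n : n.-primitive_root z -> integral z.
Proof.
move=> prim_z.
exact: integral_unity_root (prim_order_gt0 prim_z) (prim_expr_order prim_z).
Qed.

Lemma integral_rational (x : M) :
  x \in 1%VS -> integral x -> exists c : int, x = c%:~R.
Proof.
case/vlineP=> q ->{x} [P monP rootP].
have Aq : ratr q \in Aint.
  apply: (@root_monic_Aint (map_poly intr P)); last 2 first.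
  - by rewrite monic_map.
  - by apply/polyOverP=> i; rewrite coef_map /= rpred_int.
  have -> : map_poly intr P = map_poly (@ratr algC) (map_poly intr P).
    by rewrite -map_poly_comp; apply: eq_map_poly => c; rewrite /= ratr_int.
  by rewrite fmorph_root -(fmorph_root (in_alg M)) map_poly_in_alg_intr.
case/intrP: (Cint_rat_Aint (Crat_rat q) Aq) => c Dc; exists c.
rewrite -(rmorph_int (in_alg M)); congr (_ *: 1).
by apply: (fmorph_inj (@ratr algC)); rewrite /= Dc ratr_int.
Qed.

Lemma dvdz_integral (m c : int) (x : M) :
  integral x -> c%:~R = m%:~R * x -> (m %| c)%Z.
Proof.
move=> intx Dc; have [m0 | nz_m] := eqVneq m 0.
  by move/eqP: Dc; rewrite m0 mul0r fieldExt_rat_intr_eq0 => /eqP->.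
have nz_mM : m%:~R != 0 :> M by rewrite fieldExt_rat_intr_eq0.
have /integral_rational[//|d Dx] : x \in 1%VS.
  apply/vlineP; exists (c%:~R / m%:~R).
  by rewrite -in_algE fmorph_div !rmorph_int Dc mulrC mulKf.
apply/dvdzP; exists d; apply: fieldExt_rat_intr_inj.
by rewrite Dc Dx -intrM mulrC.
Qed.

(* Scaling a root by the leading coefficient [c] turns the polynomial into a
   monic one, of coefficients [q`_i * c ^+ (d - 1 - i)] below its degree [d]. *)
Lemma integral_lead_coef_mul (q : {poly int}) (t : M) :
  root (map_poly intr q) t -> integral ((lead_coef q)%:~R * t).
Proof.
move/rootP=> qt0; have [sz_q | sz_q_gt1] := leqP (size q) 1.
  move: qt0; rewrite (size1_polyC sz_q) map_polyC hornerC lead_coefC => ->.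
  by rewrite mul0r; apply: integral0.
set c := lead_coef q; set d := (size q).-1.
have d_gt0 : (0 < d)%N by rewrite ltn_predRL.
have sz_q : size q = d.+1 by rewrite prednK // ltnW.
pose R := 'X^d + \poly_(i < d) (q`_i * c ^+ (d.-1 - i)).
exists R.
  by rewrite monicE lead_coefDl ?lead_coefXn // size_polyXn ltnS size_poly.
apply/rootP; rewrite rmorphD /= map_polyXn hornerD hornerXn.
rewrite (horner_coef_wide _ (_ : _ <= d)%N); last first.
  by rewrite (leq_trans (size_poly _ _)) // size_poly.
transitivity (c%:~R ^+ d.-1 * (map_poly intr q).[t]); last by rewrite qt0 mulr0.
rewrite horner_coef size_map_inj_poly //; last exact: fieldExt_rat_intr_inj.
rewrite sz_q big_ord_recr /= mulrDr addrC mulr_sumr; congr (_ + _).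
  apply: eq_bigr => i _; rewrite !coef_map coef_poly ltn_ord /= intrM.
  have lei : (i <= d.-1)%N by rewrite -ltnS prednK.
  rewrite rmorphXn /= exprMn -mulrA [c%:~R ^+ _ * (_ * _)]mulrA -exprD.
  by rewrite subnK // mulrCA.
by rewrite coef_map /= -/c exprMn mulrA -exprSr prednK.
Qed.

Lemma exists_integral_multiple (t : M) :
  exists2 c : int, c != 0 & integral (c%:~R * t).
Proof.
have /polyOver1P[P DP] := minPolyOver 1 t.
have [q [a nz_a Dq]] := rat_poly_scale P.
exists (lead_coef q).
  rewrite lead_coef_eq0.
  apply: contraTneq (monic_neq0 (monic_minPoly 1 t)) => q0.
  by rewrite DP Dq q0 !rmorph0 scaler0 rmorph0 eqxx.
apply: integral_lead_coef_mul; have := root_minPoly 1 t.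
rewrite DP Dq map_polyZ map_poly_in_alg_intr rootZ //.
by rewrite fmorph_eq0 invr_eq0 intr_eq0.
Qed.

Lemma exists_common_integral_multiple (I : finType) (t : I -> M) :
  exists2 c : int, c != 0 & forall i, integral (c%:~R * t i).
Proof.
have /fin_all_exists2[c nz_c int_ct] i := exists_integral_multiple (t i).
exists (\prod_i c i) => [|i]; first by apply/prodf_neq0 => i _; apply: nz_c.
rewrite (bigD1 i) //= mulrC intrM mulrA [t i * _]mulrC;
  apply: integral_mul => //.
exact: integral_id.
Qed.

End NumberField.

Lemma integral_aut (M : splittingFieldType rat) (f : 'AEnd(M)) (x : M) :
  integral x -> integral (f x).
Proof.
case=> P monP rootP; exists P => //; rewrite -(fmorph_root f) in rootP.
congr (root _ _): rootP; rewrite -map_poly_comp; apply: eq_map_poly => c.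
exact: (rmorph_int f).
Qed.

Section IntAdjoin.

Variables (M : fieldExtType rat) (z : M).

Definition int_adjoin (y : M) := exists q :
  {poly int}, y = (map_poly intr q).[z].

Lemma int_adjoinP y :
  int_adjoin y <->
  exists (n : nat) (c : 'I_n -> int), y = \sum_(i < n) (c i)%:~R * z ^+ i.
Proof.
split=> [[q ->] | [n [c ->]]].
  exists (size q), (fun i => q`_i); rewrite horner_coef size_map_inj_poly //.
    by apply: eq_bigr => i _; rewrite coef_map.
  exact: fieldExt_rat_intr_inj.
exists (\sum_(i < n) c i *: 'X^i).
rewrite rmorph_sum horner_sum; apply: eq_bigr => i _.
by rewrite /= map_polyZ map_polyXn hornerZ hornerXn.
Qed.

Lemma horner_intr_sub1 (q : {poly int}) :
  exists r, (map_poly intr q).[z] = q.[1]%:~R + (z - 1) * (map_poly intr r).[z].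
Proof.
have /factor_theorem[r Dr] : root (q - q.[1]%:P) 1
  by rewrite rootE !hornerE subrr.
exists r; rewrite -[q in LHS](subrK q.[1]%:P) Dr rmorphD rmorphM /=.
by rewrite map_polyXsubC map_polyC !hornerE addrC mulrC.
Qed.

End IntAdjoin.

(** * Cyclotomic fields *)

Lemma sum_expr_root (F : fieldType) (w : F) n :
  w ^+ n = 1 -> \sum_(i < n) w ^+ i = (w == 1)%:R * n%:R.
Proof.
have [-> _ | w_neq1 wn1] := eqVneq w 1.
  by under eq_bigr do rewrite expr1n; rewrite sumr_const card_ord mul1r.
apply: (mulfI (_ : w - 1 != 0)); first by rewrite subr_eq0.
by rewrite -subrX1 wn1 subrr mul0r mulr0.
Qed.

Lemma algC_conjugate (M : fieldExtType rat) (t : M) :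
  exists2 w : algC, size (minCpoly w) = size (minPoly 1 t) &
    forall P : {poly rat}, root (map_poly ratr P) w =
      root (map_poly (in_alg M) P) t.
Proof.
have /polyOver1P[P DP] := minPolyOver 1 t.
have [w Pw0] : exists w : algC, root (map_poly ratr P) w.
  apply/closed_rootP; rewrite size_map_poly -(size_map_poly (in_alg M)) -DP.
  by rewrite size_minPoly.
have [Pw [DPw mon_Pw] min_Pw] := minCpolyP w.
have eqPw : P %= Pw.
  have dvPw : map_poly (in_alg M) Pw %| minPoly 1 t
    by rewrite DP dvdp_map -min_Pw.
  have Pw_rat : map_poly (in_alg M) Pw \is a polyOver 1%AS.
    by apply/polyOver1P; exists Pw.
  have /orP[|] := minPoly_irr Pw_rat dvPw; first by rewrite DP eqp_map eqp_sym.
  rewrite -size_poly_eq1 size_map_poly => /eqP szPw.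
  by have := size_minCpoly w; rewrite DPw size_map_poly szPw.
exists w => [|Q]; first by rewrite DPw DP !size_map_poly (eqp_size eqPw).
rewrite min_Pw -(eqp_dvdl _ eqPw) -(dvdp_map (in_alg M)) -DP.
apply/idP/idP=> [/dvdpP[r ->] | Qt0]; first by rewrite rootM root_minPoly orbT.
by rewrite minPoly_dvdp //; apply/polyOver1P; exists Q.
Qed.

Lemma mem_gal1 (F : fieldType) (M : splittingFieldType F) (E : {subfield M})
  (f : gal_of E) : f \in 'Gal(E / 1)%g.
Proof. by rewrite gal_kHom ?sub1v // k1AHom. Qed.

Section Cyclotomic.

Variables (M : splittingFieldType rat) (n : nat) (z : M).
Hypothesis prim_z : n.-primitive_root z.

Local Notation E := <<1%AS; z>>%AS.
Let n_gt0 := prim_order_gt0 prim_z.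

Lemma dim_cyclotomic : \dim E = totient n.
Proof.
rewrite dim_Fadjoin dimv1 muln1; apply/eqP; rewrite -eqSS -size_minPoly.
have [w <- eq_root] := algC_conjugate z.
have expr_eq1 d : (w ^+ d == 1) = (z ^+ d == 1).
  have rootXn1 (R : fieldType) (f : {rmorphism rat -> R}) (x : R) :
      root (map_poly f ('X^d - 1)) x = (x ^+ d == 1).
    by rewrite rmorphB rmorph1 /= map_polyXn rootE !hornerE subr_eq0.
  by rewrite -(rootXn1 _ (@ratr algC)) eq_root rootXn1.
suff prim_w : n.-primitive_root w.
  by rewrite (minCpoly_cyclotomic prim_w) size_cyclotomic.
have wn1 : w ^+ n = 1 by apply/eqP; rewrite expr_eq1 prim_expr_order.
have [m prim_w dv_mn] := prim_order_exists n_gt0 wn1.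
suff dv_nm : (n %| m)%N by have /eqP <- : m == n by rewrite eqn_dvd dv_mn.
by rewrite (prim_order_dvd prim_z) -expr_eq1 prim_expr_order.
Qed.

Lemma galois_cyclotomic : galois 1 E.
Proof.
pose r := [seq z ^+ i | i <- index_iota 0 n].
have Dr : 'X^n - 1 = \prod_(x <- r) ('X - x%:P).
  by rewrite big_map (factor_Xn_sub_1 prim_z).
apply/splitting_galoisField; exists ('X^n - 1); split.
- by rewrite rpredB ?rpredX ?polyOverX ?rpred1.
- by rewrite separable_Xn_sub_1 // fieldExt_rat_natr_eq0 -lt0n.
exists r; first by rewrite Dr eqpxx.
apply/eqP; rewrite eqEsubv; apply/andP; split.
  apply/Fadjoin_seqP; split=> [|_ /mapP[i _ ->]]; first exact: sub1v.
  by rewrite rpredX ?memv_adjoin.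
apply/FadjoinP; split; first exact: sub1v.
rewrite seqv_sub_adjoin // -root_prod_XsubC -Dr rootE !hornerE.
by rewrite (prim_expr_order prim_z) subrr.
Qed.

Lemma minPoly_cyclotomic : minPoly 1 z = cyclotomic z n.
Proof.
apply/eqP; rewrite -eqp_monic ?monic_minPoly ?cyclotomic_monic //
  -dvdp_size_eqp.
  by rewrite size_cyclotomic size_minPoly eqSS -dim_cyclotomic
    dim_Fadjoin dimv1 muln1.
have [r /= [_ Ur ->]] :=
  galois_factors (sub1v _) galois_cyclotomic z (memv_adjoin 1 z).
apply: uniq_roots_dvdp; last by rewrite uniq_rootsE.
by apply/allP=> _ /mapP[f _ ->];
  rewrite root_cyclotomic // fmorph_primitive_root.
Qed.

Lemma gal_cyclotomic_exists c : coprime c n ->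
  exists2 f : gal_of E, f \in 'Gal(E / 1)%g & f z = z ^+ c.
Proof.
move=> co_c; have [_ _ nE] := and3P galois_cyclotomic.
apply: normalField_root_minPoly => //; first exact: sub1v.
  exact: memv_adjoin.
by rewrite minPoly_cyclotomic root_cyclotomic // prim_root_exp_coprime.
Qed.

Lemma gal_cyclotomic_eq (f g : gal_of E) : f z = g z -> f = g.
Proof. by move=> eq_fg; apply/eqP;
  rewrite gal_adjoin_eq ?mem_gal1 // eq_fg. Qed.

Lemma gal_cyclotomicC (f g : gal_of E) : (f * g = g * f)%g.
Proof.
apply: gal_cyclotomic_eq; rewrite !galM ?memv_adjoin //.
exact: aut_unity_rootC n_gt0 (prim_expr_order prim_z).
Qed.

Lemma galois_sub_cyclotomic (K L : {subfield M}) :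
  (K <= L)%VS -> (L <= E)%VS -> galois K L.
Proof.
move=> sKL sLE.
have galLE : galois L E by apply: galoisS galois_cyclotomic; rewrite sub1v.
suff: galois 1 L by apply: galoisS; rewrite sub1v.
have nsG : ('Gal(E / L) <| 'Gal(E / 1))%g.
  rewrite -sub_abelian_normal ?galS ?sub1v //.
  by apply/centsP=> f _ g _; apply: gal_cyclotomicC.
have := normal_fixedField_galois galois_cyclotomic nsG.
by rewrite /galois (galois_fixedField galLE).
Qed.

(* The coefficients come from inverting the discrete Fourier transform
   [f y * f z ^- i] of the conjugates of [y]. *)
Lemma cyclotomic_trace_expansion y : y \in E ->
  n%:R * y = \sum_(i < n) galTrace 1 E (y * z ^- i) * z ^+ i.
Proof.
move=> Ey; have nz_z : z != 0 by rewrite (prim_root_eq0 prim_z) -lt0n.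
have sum_conj (f : gal_of E) :
    \sum_(i < n) ((f z)^-1 * z) ^+ i = (f == 1%g)%:R * n%:R.
  rewrite sum_expr_root; last first.
    by rewrite exprMn exprVn -rmorphXn (prim_expr_order prim_z)
      rmorph1 invr1 mulr1.
  congr (_%:R * _); have nz_fz : f z != 0 by rewrite fmorph_eq0.
  rewrite -(inj_eq (mulfI nz_fz)) mulVKf // mulr1 eq_sym; congr nat_of_bool.
  by apply/eqP/eqP=> [fz | ->]; [apply: gal_cyclotomic_eq |]; rewrite gal_id.
transitivity (\sum_(f in 'Gal(E / 1)%g) f y * \sum_(i < n) ((f z)^-1 * z) ^+ i).
  rewrite (bigD1 1%g) ?group1 //=
    sum_conj eqxx mul1r gal_id mulrC big1 ?addr0 //.
  by move=> f /andP[_ /negPf f_neq1]; rewrite sum_conj f_neq1 mul0r mulr0.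
under eq_bigr do rewrite mulr_sumr.
rewrite exchange_big; apply: eq_bigr => i _; rewrite /galTrace mulr_suml.
by apply: eq_bigr => f _; rewrite rmorphM fmorphV rmorphXn exprMn exprVn mulrA.
Qed.

Lemma int_adjoin_mul_order y : y \in E -> integral y -> int_adjoin z (n%:R * y).
Proof.
move=> Ey inty; apply/int_adjoinP.
have Ezi i : z ^+ i \in E by rewrite rpredX ?memv_adjoin.
have /fin_all_exists[c Dc] (i : 'I_n) :
    exists c : int, galTrace 1 E (y * z ^- i) = c%:~R.
  apply: integral_rational.
    by apply: mem_galTrace galois_cyclotomic _; rewrite rpredM ?rpredV.
  apply: integral_sum => f _; apply/integral_aut/integral_mul => //.
  apply: (integral_unity_root n_gt0).
  by rewrite exprVn exprAC (prim_expr_order prim_z) expr1n invr1.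
by exists n, c; rewrite cyclotomic_trace_expansion //; apply: eq_bigr => i _;
  rewrite Dc.
Qed.

End Cyclotomic.

Lemma exprD_prime_power (R : comNzRingType) (p m : nat) (x y : R) : prime p ->
  exists r, (x + y) ^+ (p ^ m) = x ^+ (p ^ m) + y ^+ (p ^ m) + r *+ p.
Proof.
move=> p_pr; have p_gt0 := prime_gt0 p_pr.
have exprDp (a b : R) : exists r, (a + b) ^+ p = a ^+ p + b ^+ p + r *+ p.
  exists (\sum_(i < p.-1) (a ^+ (p - i.+1) * b ^+ i.+1) *+ ('C(p, i.+1) %/ p)).
  rewrite exprDn big_ord_recl -[in X in _ + X](prednK p_gt0) big_ord_recr /=.
  rewrite /bump /=
    add1n prednK // subnn subn0 bin0 binn !expr0 mulr1 mul1r !mulr1n.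
  rewrite addrCA addrC -sumrMnl; congr (_ + _); apply: eq_bigr => i _.
  rewrite -mulrnA divnK ?add1n // prime_dvd_bin //.
  by rewrite -ltn_predRL ltn_ord.
elim: m => [|m [r IHm]]; first by exists 0; rewrite !expr1 mul0rn addr0.
have [r1 D1] := exprDp (x ^+ (p ^ m) + y ^+ (p ^ m)) (r *+ p).
have [r2 D2] := exprDp (x ^+ (p ^ m)) (y ^+ (p ^ m)).
exists (r2 + r ^+ p *+ (p ^ p.-1) + r1).
rewrite expnSr !exprM IHm D1 D2 !mulrnDl exprMn_n -!addrA; do 3!congr (_ + _).
by rewrite -mulrnA -expnSr prednK.
Qed.

Section PrimePowerCyclotomic.

Variables (M : splittingFieldType rat) (p m : nat) (z : M).
Hypothesis p_pr : prime p.
Hypothesis prim_z : (p ^ m.+1).-primitive_root z.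

Local Notation ev q := (map_poly intr q).[z].

Let nz_z1 : z - 1 != 0.
Proof.
rewrite subr_eq0 -[z]expr1 -(prim_order_dvd prim_z) dvdn1.
by rewrite -(expn0 p) eqn_exp2l // prime_gt1.
Qed.

Lemma prim_root_sub1_dvd_prime : exists r : {poly int}, p%:R = (z - 1) * ev r.
Proof.
pose Phi : {poly int} := \sum_(i < p) 'X^(p ^ m) ^+ i.
have [r Dr] := horner_intr_sub1 z Phi; exists (- r).
have Phi_z : ev Phi = 0.
  rewrite rmorph_sum horner_sum.
  under eq_bigr do rewrite rmorphXn /= map_polyXn horner_exp hornerXn.
  rewrite sum_expr_root -?exprM -?expnSr ?(prim_expr_order prim_z) //.
  rewrite -(prim_order_dvd prim_z) dvdn_Pexp2l ?prime_gt1 // ltnn.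
  by rewrite mul0r.
have Phi_1 : Phi.[1] = p%:Z.
  rewrite horner_sum; under eq_bigr do rewrite horner_exp hornerXn !expr1n.
  by rewrite sumr_const card_ord; apply: natz.
by rewrite rmorphN hornerN mulrN; apply/eqP; rewrite -addr_eq0 -Phi_z Dr Phi_1.
Qed.

Lemma prime_dvd_prim_root_sub1_expr :
  exists r : {poly int}, (z - 1) ^+ (p ^ m.+1) = p%:R * ev r.
Proof.
have [r Dr] := exprD_prime_power m.+1 ('X - 1 : {poly int}) 1 p_pr.
exists (- r); have := congr1 (fun q => ev q) Dr.
rewrite subrK expr1n !rmorphD /= !rmorphXn rmorphB rmorphMn !rmorph1 /=
  map_polyX.
rewrite !hornerE (prim_expr_order prim_z) addrAC -[LHS]add0r => /addIr/esym/eqP.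
by rewrite addr_eq0 hornerMn -mulr_natl rmorphN hornerN mulrN => /eqP.
Qed.

(* Modulo [z - 1] an element of [Z[z]] is a rational integer, and a rational
   integer that is a multiple of [z - 1] is a multiple of [p]. *)
Lemma int_adjoin_div_prim_root_sub1 y :
  integral y -> int_adjoin z ((z - 1) * y) -> int_adjoin z y.
Proof.
move=> inty [q Dq]; have [r Dr] := horner_intr_sub1 z q.
have [r0 Dr0] := prim_root_sub1_dvd_prime;
  have [r1 Dr1] := prime_dvd_prim_root_sub1_expr.
have int_ev s : integral (ev s).
  rewrite horner_coef; apply: integral_sum => i _; rewrite coef_map.
  apply: integral_mul; first exact: integral_id.
  exact/integral_exp/(integral_prim_root prim_z).
have Dc : q.[1]%:~R = (z - 1) * (y - ev r) by rewrite mulrBr Dq Dr addrK.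
have /dvdzP[d Dd] : (p%:Z %| q.[1])%Z.
  suff : (p%:Z %| q.[1] ^+ (p ^ m.+1))%Z.
    by rewrite !dvdzE abszX Euclid_dvdX // => /andP[].
  apply: (@dvdz_integral M _ _ (ev r1 * (y - ev r) ^+ (p ^ m.+1))).
    by apply: integral_mul => //; apply/integral_exp/integral_sub.
  by rewrite rmorphXn /= Dc exprMn Dr1 mulrA.
exists (r + d *: r0); apply: (mulfI nz_z1); rewrite Dq Dr Dd intrM.
rewrite rmorphD /= map_polyZ !hornerE mulrDr [RHS]addrC; congr (_ + _).
by rewrite mulrCA -Dr0 mulrC.
Qed.

Theorem integral_cyclotomic_prime_power y :
  y \in <<1; z>>%VS -> integral y -> int_adjoin z y.
Proof.
move=> Ey inty; have [r Dr] := prime_dvd_prim_root_sub1_expr.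
have [q Dq] := int_adjoin_mul_order prim_z Ey inty.
have: int_adjoin z ((z - 1) ^+ (p ^ m.+1 * m.+1) * y).
  exists (r ^+ m.+1 * q); rewrite exprM Dr exprMn -natrX mulrAC Dq mulrC.
  by rewrite rmorphM rmorphXn hornerM horner_exp.
elim: (_ * _)%N => [|e IHe]; first by rewrite mul1r.
rewrite exprS -mulrA => /int_adjoin_div_prim_root_sub1/IHe; apply.
apply: integral_mul => //; apply/integral_exp/integral_sub;
  last exact: integral1.
exact: integral_prim_root prim_z.
Qed.

End PrimePowerCyclotomic.

(** * The action of the group algebra *)

Section GroupAlgebra.

Variables (M : splittingFieldType rat) (K E : {subfield M}).

Local Notation G := 'Gal(E / K)%G.

Fact ga_act_is_zmod_morphism (a : group_algebra K E) : zmod_morphism (ga_act a).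
Proof.
by move=> x y; rewrite -sumrB; apply: eq_bigr => g _; rewrite rmorphB mulrBr.
Qed.

HB.instance Definition _ (a : group_algebra K E) :=
  GRing.isZmodMorphism.Build M M (ga_act a) (ga_act_is_zmod_morphism a).

Definition ga_of (c : subg_of G -> M) : group_algebra K E :=
  [ffun g => vsproj K (c g)].

Lemma ga_ofE c g : c g \in K -> vsval (ga_of c g) = c g.
Proof. by move=> Kc; rewrite ffunE vsprojK. Qed.

Lemma ga_act_of c x : (forall g, c g \in K) ->
  ga_act (ga_of c) x = \sum_g c g * (sgval g : gal_of E) x.
Proof. by move=> Kc; apply: eq_bigr => g _; rewrite ga_ofE. Qed.

Lemma ga_act0 t : ga_act (0 : group_algebra K E) t = 0.
Proof. by rewrite /ga_act big1 // => g _; rewrite ffunE mul0r. Qed.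

Lemma ga_actB (a b : group_algebra K E) t :
  ga_act (a - b) t = ga_act a t - ga_act b t.
Proof.
by rewrite -sumrB; apply: eq_bigr => g _; rewrite !ffunE raddfB mulrBl.
Qed.

Lemma ga_actZ c (a : group_algebra K E) t : ga_act (c *: a) t = c *: ga_act a t.
Proof.
by rewrite /ga_act scaler_sumr; apply: eq_bigr => g _;
  rewrite ffunE linearZ -scalerAl.
Qed.

Lemma ga_act_eq0 (a : group_algebra K E) :
  {in E, forall t, ga_act a t = 0} -> a = 0.
Proof.
move=> a0; apply/ffunP=> g; apply/val_inj; rewrite ffunE; rewrite -[g]sgvalK.
pose c h := vsval (a (subg _ h)).
apply: (gal_independent (P := [in 'Gal(E / K)%g]) (c_ := c)); last exact: subgP.
move=> t Et; rewrite -[RHS](a0 t Et) /ga_act.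
rewrite (reindex_onto (subg G) sgval) => [|h _]; last exact: sgvalK.
apply: eq_big => [h | h Gh]; last by rewrite subgK.
by rewrite /=; apply/idP/eqP => [/subgK | <-]; [| apply: subgP].
Qed.

Hypothesis sKE : (K <= E)%VS.

Lemma mem_ga_act (a : group_algebra K E) t : t \in E -> ga_act a t \in E.
Proof.
move=> Et; rewrite /ga_act rpred_sum // => g _.
by rewrite rpredM ?memv_gal // (subvP sKE) ?subvsP.
Qed.

Lemma ga_act_comp (a b : group_algebra K E) t : t \in E ->
  ga_act a (ga_act b t) =
    \sum_g \sum_h vsval (a g) * vsval (b h) * (sgval (h * g)%g : gal_of E) t.
Proof.
move=> Et; apply: eq_bigr => g _; rewrite rmorph_sum mulr_sumr.
apply: eq_bigr => h _.
by rewrite rmorphM /= (fixed_gal sKE (subgP g) (subvsP _)) mulrA galM.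
Qed.

Lemma ga_actC (a b : group_algebra K E) t : abelian G -> t \in E ->
  ga_act a (ga_act b t) = ga_act b (ga_act a t).
Proof.
move=> abG Et; rewrite !ga_act_comp // exchange_big.
apply: eq_bigr => h _; apply: eq_bigr => g _; rewrite [vsval (a g) * _]mulrC.
congr (_ * (_ : gal_of E) t) => /=.
by rewrite (centsP abG) ?subgP.
Qed.

Definition galois_operator (f : M -> M) :=
  exists a : group_algebra K E, {in E, f =1 ga_act a}.

Lemma galois_operator_scale c f :
  c \in K -> galois_operator f -> galois_operator (fun t => c * f t).
Proof.
move=> Kc [a Df]; exists (ga_of (fun g => c * vsval (a g))) => t Et.
rewrite ga_act_of => [|g]; last by rewrite rpredM ?subvsP.
by rewrite Df // mulr_sumr; apply: eq_bigr => g _; rewrite mulrA.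
Qed.

Lemma galois_operator_sum (I : finType) (f : I -> M -> M) :
  (forall i, galois_operator (f i)) -> galois_operator (fun t => \sum_i f i t).
Proof.
move=> /fin_all_exists[a Df].
exists (ga_of (fun g => \sum_i vsval (a i g))) => t Et.
rewrite ga_act_of => [|g]; last by apply: rpred_sum => i _; apply: subvsP.
under eq_bigr do rewrite Df //.
by rewrite exchange_big; apply: eq_bigr => g _; rewrite mulr_suml.
Qed.

Lemma galois_operator_gal (g : gal_of E) : g \in 'Gal(E / K)%g ->
  galois_operator g.
Proof.
move=> Gg; exists (ga_of (fun h => (h == subg _ g)%:R)) => t Et.
rewrite ga_act_of => [|h]; last exact: rpred_nat.
rewrite (bigD1 (subg _ g)) //= eqxx mul1r subgK // big1 ?addr0 // => h /negPf->.
by rewrite mul0r.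
Qed.

Lemma galois_operator_comp f f' :
  galois_operator f -> galois_operator f' -> galois_operator (f \o f').
Proof.
move=> [a Df] [b Df'].
exists (ga_of (fun k => \sum_g vsval (a g) * vsval (b (k * g^-1)%g))) => t Et.
rewrite ga_act_of => [|k]; last by apply: rpred_sum => g _;
  rewrite rpredM ?subvsP.
rewrite /= Df' // Df ?mem_ga_act // ga_act_comp //.
under [RHS]eq_bigr do rewrite mulr_suml.
rewrite [RHS]exchange_big; apply: eq_bigr => g _.
by rewrite [RHS](reindex_inj (mulIg g)); apply: eq_bigr => h _; rewrite mulgK.
Qed.

Lemma associated_order_lincomb n (c : 'I_n -> int)
  (a : 'I_n -> group_algebra K E) :
    (forall i, associated_order (a i)) ->
  exists2 b : group_algebra K E, associated_order b &
    {in E, forall t, ga_act b t = \sum_i (c i)%:~R * ga_act (a i) t}.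
Proof.
move=> aA; have [b Db] :
  galois_operator (fun t => \sum_i (c i)%:~R * ga_act (a i) t).
  apply: galois_operator_sum => i; apply: galois_operator_scale;
    last by exists (a i).
  exact: rpred_int.
exists b => [t [Et intt] | t Et]; last by rewrite -Db.
split; first exact: mem_ga_act.
rewrite -Db //; apply: integral_sum => i _; apply: integral_mul;
  first exact: integral_id.
by have [] := aA i t (conj Et intt).
Qed.

(* Clearing denominators turns relations over the group algebra into relations
   over the associated order. *)
Lemma integers_basis_free n (e : 'I_n -> M) (a : 'I_n -> group_algebra K E) :
  integers_basis K E e -> \sum_i ga_act (a i) (e i) = 0 -> forall i, a i = 0.
Proof.
move=> [Oe basis_e] ae0.
have [c nz_c int_ca] :=
  exists_common_integral_multiple
    (fun ig : 'I_n * subg_of G => vsval (a ig.1 ig.2)).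
have caA i : associated_order (c%:~R *: a i).
  move=> t [Et intt]; split; first exact: mem_ga_act.
  apply: integral_sum => g _; apply: integral_mul; last exact: integral_aut.
  rewrite ffunE linearZ /= scaler_int -mulrzl; exact: (int_ca (i, g)).
have O0 : ring_of_integers E 0 by split; [apply: mem0v | apply: integral0].
have [b [_ uniq_b]] := basis_e 0 O0.
have /ffunP eq0 : [ffun i => c%:~R *: a i] = [ffun=> 0].
  transitivity b; last apply: uniq_b; first (apply/esym/uniq_b; split=> [i | ]).
  - by rewrite ffunE.
  - by under eq_bigr do rewrite ffunE ga_actZ; rewrite -scaler_sumr ae0 scaler0.
  split=> [i t Ot | ]; first by rewrite ffunE ga_act0.
  by rewrite big1 // => i _; rewrite ffunE ga_act0.
move=> i; move/eqP: (eq0 i); rewrite !ffunE scaler_eq0 intr_eq0 (negPf nz_c).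
by move/eqP.
Qed.

Lemma integers_basis_inj n (e : 'I_n -> M) (a b : 'I_n -> group_algebra K E) :
    integers_basis K E e ->
    \sum_i ga_act (a i) (e i) = \sum_i ga_act (b i) (e i) ->
  a =1 b.
Proof.
move=> basis_e /eqP; rewrite -subr_eq0 -sumrB => /eqP ab0 i.
apply/subr0_eq; apply: (integers_basis_free (a := fun j => a j - b j) basis_e).
by rewrite -[RHS]ab0; apply: eq_bigr => j _; rewrite ga_actB.
Qed.

Lemma integers_basis_cyclic (x : M) :
    abelian G -> ring_of_integers E x ->
    (forall y, ring_of_integers E y ->
       exists2 a : group_algebra K E, associated_order a & y = ga_act a x) ->
  integers_basis K E (fun _ : 'I_1 => x).
Proof.
move=> abG Ox gen; split=> // y /gen[a aA Dy].
exists [ffun=> a]; split=> [|b [_ Dyb]].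
  by rewrite big_ord1 ffunE; split=> // i; rewrite ffunE.
rewrite big_ord1 in Dyb; apply/ffunP=> i; rewrite ffunE ord1.
apply/subr0_eq/ga_act_eq0 => t Et;
  have [c nz_c intct] := exists_integral_multiple t.
have nz_cM : c%:~R != 0 :> M by rewrite fieldExt_rat_intr_eq0.
have [|d _ Dct] := gen (c%:~R * t); first by split;
  rewrite // rpredM ?rpred_int.
apply: (mulfI nz_cM); rewrite mulr0 mulrzl -raddfMz -mulrzl /= Dct.
by rewrite ga_actC ?(proj1 Ox) // ga_actB -Dy -Dyb subrr raddf0.
Qed.

End GroupAlgebra.

(** * Relative cyclotomic extensions *)

Section SameClass.

Local Open Scope nat_scope.

Variables q S : nat.

(* The classes are the orbits of the multipliers [1 + q * t] on the integers
   modulo [S]. *)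
Definition same_class : rel nat := fun i j => i == j %[mod gcdn S (q * j)].

Lemma eq_same_class i1 i2 j1 j2 : i1 = i2 %[mod S] -> j1 = j2 %[mod S] ->
  same_class i1 j1 = same_class i2 j2.
Proof.
move=> eq_i eq_j; rewrite /same_class.
have -> : gcdn S (q * j1) = gcdn S (q * j2).
  by rewrite -gcdn_modr -modnMmr eq_j modnMmr gcdn_modr.
have dvdS : gcdn S (q * j2) %| S by apply: dvdn_gcdl.
by rewrite -(modn_dvdm i1 dvdS) eq_i -(modn_dvdm j1 dvdS) eq_j !modn_dvdm.
Qed.

Lemma same_classP i j : 0 < S ->
  reflect (exists t, i = (1 + q * t) * j %[mod S]) (same_class i j).
Proof.
move=> S_gt0; set d := gcdn S (q * j).
have [dvdS dvdqj] : d %| S /\ d %| q * j by rewrite dvdn_gcdl dvdn_gcdr.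
apply: (iffP eqP) => [eq_ij | [t Dt]]; last first.
  rewrite -/d -(modn_dvdm i dvdS) Dt modn_dvdm // mulnDl mul1n mulnAC.
  by rewrite -modnDmr -modnMml (eqP dvdqj) mod0n addn0.
have [a _ dvSd] := Bezoutl (q * j) S_gt0; rewrite -/d in dvSd.
have lej : j <= i + S * j by rewrite (leq_trans (leq_pmull _ S_gt0)) ?leq_addl.
have /dvdnP[e De] : d %| i + S * j - j.
  by rewrite -eqn_mod_dvd // -modnDmr -modnMml (eqP dvdS) mod0n addn0 eq_ij.
have Di : i = j + e * d %[mod S].
  by rewrite -De subnKC // -modnDmr modnMr addn0.
exists (S.-1 * a * e); rewrite Di mulnDl mul1n; apply/eqP; rewrite eqn_modDl.
rewrite -(eqn_modDr (e * (a * (q * j)))) -mulnDr -modnMmr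
  (eqP dvSd) muln0 mod0n.
have -> : q * (S.-1 * a * e) * j + e * (a * (q * j)) =
  S.-1.+1 * (a * e * q * j).
  by rewrite mulSn addnC; congr (_ + _); ring.
by rewrite prednK // modnMr.
Qed.

Hypothesis S_gt0 : 0 < S.
(* Every prime factor of [S] divides [q]. *)
Hypothesis coprime_S : forall c, coprime q c -> coprime S c.

Lemma coprime_multiplier t : coprime (q * S) (1 + q * t).
Proof.
have co_q : coprime q (1 + q * t) by rewrite /coprime addnC mulnC gcdnMDl gcdn1.
by rewrite coprimeMl co_q coprime_S.
Qed.

Lemma same_class_modulus i j :
  same_class i j -> gcdn S (q * i) = gcdn S (q * j).
Proof.
case/(same_classP _ _ S_gt0)=> t Dt.
rewrite -gcdn_modr -modnMmr Dt modnMmr gcdn_modr mulnCA Gauss_gcdr //.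
by have := coprime_multiplier t; rewrite coprimeMl => /andP[].
Qed.

Lemma same_class_equiv : equivalence_rel same_class.
Proof.
move=> i j l; split=> [|Cij]; first exact: eqxx.
have sym i1 i2 : same_class i1 i2 -> same_class i2 i1.
  by move=> C12; rewrite /same_class (same_class_modulus C12) eq_sym.
have trans i1 i2 i3 : same_class i1 i2 -> same_class i2 i3 -> same_class i1 i3.
  move=> C12 C23; move: C12 (C23); rewrite /same_class (same_class_modulus C23).
  by move=> /eqP->.
by apply/idP/idP; apply: trans => //; apply: sym.
Qed.

Lemma same_classMl c i j : same_class i j -> same_class (c * i) (c * j).
Proof.
case/(same_classP _ _ S_gt0)=> t Dt; apply/same_classP => //.
by exists t; rewrite -[LHS]modnMmr Dt modnMmr mulnCA.
Qed.

End SameClass.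

Section RelativeCyclotomic.

Variables (M : splittingFieldType rat) (q S : nat) (z : M).
Hypothesis prim_z : (q * S).-primitive_root z.
Hypothesis coprime_S : forall c, coprime q c -> coprime S c.

Local Notation F := <<1%AS; z>>%AS.
Local Notation K := <<1%AS; z ^+ S>>%AS.
Local Notation same_class := (same_class q S).

Hypothesis integers_F : forall y, ring_of_integers F y -> int_adjoin z y.

Let qS_gt0 : (0 < q * S)%N. Proof. exact: prim_order_gt0 prim_z. Qed.
Let S_gt0 : (0 < S)%N. Proof. by move: qS_gt0; rewrite muln_gt0 => /andP[]. Qed.
Let nz_z i : z ^+ i != 0.
Proof. by rewrite expf_neq0 // (prim_root_eq0 prim_z) -lt0n. Qed.
Let Fz i : z ^+ i \in F. Proof. by rewrite rpredX ?memv_adjoin. Qed.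
Let Kz i : z ^+ S ^+ i \in K. Proof. by apply: rpredX; apply: memv_adjoin. Qed.

Lemma sub_relative_cyclotomic : (K <= F)%VS.
Proof. by apply/FadjoinP; rewrite sub1v /= Fz. Qed.
Let sKF := sub_relative_cyclotomic.

Lemma gal_relative_exists t :
  exists2 g : gal_of F, g \in 'Gal(F / K)%g & g z = z ^+ (1 + q * t).
Proof.
have [|g _ gz] := gal_cyclotomic_exists prim_z (c := 1 + q * t).
  by rewrite coprime_sym coprime_multiplier.
exists g => //; rewrite -sub1set galois_connection //.
apply/FadjoinP; split; first exact: sub1v.
apply/(fixedFieldP (Fz _)) => _ /set1P->; rewrite rmorphXn /= gz -exprM.
rewrite mulnDl mul1n mulnAC exprD [in X in _ * X]exprM (prim_expr_order prim_z).
by rewrite expr1n mulr1.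
Qed.

Lemma prim_root_ratio_mem i j : (i = j %[mod S])%N -> z ^+ i / z ^+ j \in K.
Proof.
move=> eq_ij; rewrite [i](divn_eq i S) [j](divn_eq j S) eq_ij !exprD.
rewrite invfM mulrACA divff // mulr1 ![(_ * S)%N]mulnC !exprM.
by rewrite rpredM ?rpredV.
Qed.

(* The idempotent of [K[G]] for the character
   [h_u |-> z ^+ (q * (S / d) * j * u)] of the subgroup of the
   [h_u : z |-> z ^+ (1 + q * (S / d) * u)]. *)
Lemma class_projector j : exists2 e : M -> M, galois_operator K F e &
  forall i, e (z ^+ i) = if same_class i j then z ^+ i else 0.
Proof.
set d := gcdn S (q * j).
have [dvdS dvdqj] : (d %| S /\ d %| q * j)%N by rewrite dvdn_gcdl dvdn_gcdr.
have d_gt0 : (0 < d)%N by rewrite gcdn_gt0 S_gt0.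
pose W := z ^+ (q * (S %/ d)).
have prim_W : d.-primitive_root W.
  by rewrite /W muln_divA // dvdn_prim_root // dvdn_mull.
have Wd1 m : W ^+ m ^+ d = 1 by rewrite exprAC (prim_expr_order prim_W) expr1n.
have KW : W ^+ j \in K.
  rewrite -exprM mulnAC muln_divA // [(_ * S)%N]mulnC -muln_divA // exprM.
  exact: Kz.
have /fin_all_exists2[h Gh hz] (u : 'I_d) := gal_relative_exists (S %/ d * u).
pose f (u : 'I_d) (t : M) := d%:R^-1 * (W ^+ j) ^- u * h u t.
exists (fun t => \sum_u f u t).
  apply: galois_operator_sum => u.
  apply: galois_operator_scale; last exact: galois_operator_gal.
  by apply: rpredM; rewrite rpredV; [apply: rpred_nat | apply: rpredX].
have nzd : d%:R != 0 :> M by rewrite fieldExt_rat_natr_eq0 -lt0n.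
have nzW : W ^+ j != 0 by rewrite -exprM.
move=> i; transitivity (d%:R^-1 * z ^+ i * \sum_(u < d) (W ^+ i / W ^+ j) ^+ u).
  rewrite mulr_sumr; apply: eq_bigr => u _; rewrite /f rmorphXn /= hz.
  rewrite mulnA exprD expr1 exprMn exprM -/W expr_div_n -!exprM
    [(u * i)%N]mulnC.
  by rewrite mulrACA; congr (_ * _); rewrite mulrC.
rewrite sum_expr_root; last by rewrite expr_div_n !Wd1 divr1.
rewrite (can2_eq (mulfVK nzW) (mulfK nzW)) mul1r (eq_prim_root_expr prim_W).
rewrite -/(same_class i j).
by case: ifP => _; rewrite ?mul0r ?mulr0 // mul1r mulrAC mulVf ?mul1r.
Qed.

Lemma associated_order_int_adjoin (a : group_algebra K F) :
  (forall l, integral (ga_act a (z ^+ l))) -> associated_order a.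
Proof.
move=> int_az t Ot; split; first exact: mem_ga_act (proj1 Ot).
have /int_adjoinP[n [c ->]] := integers_F Ot.
rewrite raddf_sum; apply: integral_sum => l _; rewrite mulrzl raddfMz -mulrzl.
by apply: integral_mul; [apply: integral_id | apply: int_az].
Qed.

Lemma class_transport i j : same_class i j ->
  exists a : group_algebra K F,
    [/\ associated_order a, ga_act a (z ^+ j) = z ^+ i
      & forall l, ~~ same_class l j -> ga_act a (z ^+ l) = 0].
Proof.
case/(same_classP _ _ _ S_gt0)=> t Dt.
have [e ope De] := class_projector j.
have [g Gg gz] := gal_relative_exists t.
pose c := z ^+ i / z ^+ ((1 + q * t) * j).
have [a Da] : galois_operator K F (fun y => c * (g \o e) y).
  apply: galois_operator_scale; first exact: prim_root_ratio_mem.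
  by apply: galois_operator_comp => //; apply: galois_operator_gal.
have {}Da l : ga_act a (z ^+ l) = if same_class l j then c * g (z ^+ l) else 0.
  by rewrite -Da //= De; case: ifP => // _; rewrite rmorph0 mulr0.
exists a; split=> [||l /negPf nClj]; rewrite ?Da ?nClj //.
  apply: associated_order_int_adjoin => l; rewrite Da.
  case: ifP => _; last exact: integral0.
  apply: (integral_unity_root qS_gt0); rewrite exprMn -rmorphXn expr_div_n.
  by rewrite !(exprAC _ _ (q * S)) (prim_expr_order prim_z) !expr1n
    rmorph1 divr1 mulr1.
by rewrite /same_class eqxx rmorphXn /= gz -exprM mulfVK.
Qed.

(* Twisting by the operators of [class_transport] carries the sum to any power
   of [z]. *)
Theorem class_sum_basis (X : {set 'I_(q * S)}) :
    (forall j, exists2 i : 'I_(q * S), i \in X & same_class j i) ->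
    {in X &, forall i j : 'I_(q * S), same_class i j -> i = j} ->
  integers_basis K F (fun _ : 'I_1 => \sum_(i in X) z ^+ i).
Proof.
move=> X_cover X_inj.
have Fx : \sum_(i in X) z ^+ i \in F by apply: rpred_sum.
apply: integers_basis_cyclic => //.
- by apply/centsP=> f _ g _; apply: gal_cyclotomicC prim_z _ _.
- split=> //; apply: integral_sum => i _.
  exact/integral_exp/(integral_prim_root prim_z).
have transport l : exists2 a : group_algebra K F,
    associated_order a & ga_act a (\sum_(i in X) z ^+ i) = z ^+ l.
  have [r Xr Clr] := X_cover l; have [a [aA az_r az_0]] := class_transport Clr.
  exists a => //;
    rewrite raddf_sum (bigD1 r) //= az_r big1 ?addr0 // => i /andP[Xi].
  by move=> neq_ir; apply: az_0; apply: contraNN neq_ir => /X_inj->.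
move=> y /integers_F/int_adjoinP[n [c Dy]].
have /fin_all_exists2[a aA az] (l : 'I_n) := transport l.
have [b bA Db] := associated_order_lincomb sKF c aA.
by exists b => //; rewrite Dy Db //; apply: eq_bigr => l _; rewrite az.
Qed.

End RelativeCyclotomic.

(** * Descent to a linearly disjoint extension *)

Lemma gal_eq1 (F : fieldType) (M : splittingFieldType F) (E : {subfield M})
    (g : gal_of E) : (E <= fixedField [set g])%VS -> g = 1%g.
Proof.
move/subvP=> fixE; apply/eqP/gal_eqP=> t /fixE/mem_fixedFieldP[_ ->].
  by rewrite gal_id.
exact: set11.
Qed.

Section LinearlyDisjoint.

Variables (F : fieldType) (M : splittingFieldType F) (K K' L E : {subfield M}).
Hypotheses (galKE : galois K E) (galKK' : galois K K') (galKL : galois K L).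
Hypotheses (cap_K : (K' :&: L)%VS = K) (prod_E : (K' * L)%VS = E).

Let sKK'E : (K <= K' <= E)%VS.
Proof. by rewrite -prod_E field_subvMr andbT; case/and3P: galKK'. Qed.
Let sKLE : (K <= L <= E)%VS.
Proof. by rewrite -prod_E field_subvMl andbT; case/and3P: galKL. Qed.
Let nKK' : normalField K K'. Proof. by case/and3P: galKK'. Qed.
Let nKL : normalField K L. Proof. by case/and3P: galKL. Qed.
Let sKE : (K <= E)%VS. Proof. by case/and3P: galKE. Qed.
Let sK'E : (K' <= E)%VS. Proof. by case/andP: sKK'E. Qed.
Let sLE : (L <= E)%VS. Proof. by case/andP: sKLE. Qed.

Local Notation G := 'Gal(E / K')%G.
Local Notation D := 'Gal(E / L)%G.

Lemma disjoint_gal_TI : (G :&: D = 1)%g.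
Proof.
apply/trivgP/subsetP=> g /setIP[Gg Dg]; apply/set1P/gal_eq1.
suff : (K' * L <= fixedField [set g])%VS by rewrite prod_E.
by rewrite prodv_sub // -galois_connection ?sub1set.
Qed.

Lemma disjoint_gal_cent : G \subset 'C(D)%g.
Proof.
have nG := normalField_normal sKK'E nKK'.
have nD := normalField_normal sKLE nKL.
apply/commG1P/trivgP; rewrite -disjoint_gal_TI commg_subI //.
  by rewrite subsetI subxx (subset_trans (normal_sub nG)) ?normal_norm.
by rewrite subsetI subxx (subset_trans (normal_sub nD)) ?normal_norm.
Qed.

Lemma disjoint_gal_mul : (D * G = 'Gal(E / K))%g.
Proof.
rewrite -(cent_joinEr disjoint_gal_cent) -[LHS]gal_fixedField;
  congr 'Gal(E / _)%g.
have galK'E : galois K' E by apply: galoisS galKE.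
have galLE : galois L E by apply: galoisS galKE.
apply/eqP; rewrite eqEsubv -[X in (_ <= X)%VS]cap_K subv_cap; apply/andP; split.
  rewrite -[X in (_ <= X)%VS && _](galois_fixedField galK'E).
  rewrite -[X in _ && (_ <= X)%VS](galois_fixedField galLE).
  by rewrite !fixedFieldS ?joing_subl ?joing_subr.
by rewrite -galois_connection // join_subG !galS //; case/andP: sKK'E;
  case/andP: sKLE.
Qed.

Lemma disjoint_gal_restriction :
  exists2 r : subg_of G -> subg_of 'Gal(L / K)%G, bijective r &
    forall g, {in L, (sgval (r g) : gal_of L) =1 (sgval g : gal_of E)}.
Proof.
pose r (g : subg_of G) : subg_of 'Gal(L / K)%G :=
  subg _ (normalField_cast L (sgval g)).
have sGK : G \subset 'Gal(E / K)%g by apply: galS; case/andP: sKK'E.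
have rE g : {in L, (sgval (r g) : gal_of L) =1 (sgval g : gal_of E)}.
  have Kg : sgval g \in 'Gal(E / K)%g by apply: subsetP sGK _ (subgP g).
  move=> t Lt; rewrite /r subgK; first exact: normalField_cast_eq Kg t Lt.
  by rewrite /= -(normalField_img galKE sKLE nKL) mem_morphim.
have r_inj : injective r.
  move=> g h eq_r; apply/subg_inj/eqP; rewrite eq_mulgV1.
  suff : (sgval g * (sgval h)^-1 \in G :&: D)%g
    by rewrite disjoint_gal_TI => /set1P->.
  rewrite inE groupM ?groupV ?subgP //= gal_kHom //; apply/kAHomP=> t Lt.
  have Et := subvP sLE t Lt.
  by rewrite galM // -rE // eq_r rE // -galM // mulgV gal_id.
have /fin_all_exists[l rK] h : exists g, r g = h.
  have : sgval h \in (normalField_cast L @: 'Gal(E / K))%g.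
    by rewrite -(morphimEdom (normalField_cast_morphism sKLE nKL))
      normalField_img ?subgP.
  rewrite -disjoint_gal_mul => /imsetP[_ /mulsgP[d g Dd Gg ->] Dh].
  exists (subg G g); apply/subg_inj/eqP/gal_eqP=> t Lt.
  have Kdg : (d * g)%g \in 'Gal(E / K)%g by rewrite -disjoint_gal_mul mem_mulg.
  rewrite rE // subgK // Dh (normalField_cast_eq sKLE nKL) ?galM
    ?(subvP sLE) //.
  by rewrite (fixed_gal sLE Dd).
by exists r => //; exists l => // g; apply: r_inj; rewrite rK.
Qed.

Lemma disjoint_dim : \dim_K' E = \dim_K L.
Proof.
have [r /bij_eq_card + _] := disjoint_gal_restriction; rewrite !card_sub.
have galK'E : galois K' E by apply: galoisS galKE.
by rewrite (galois_dim galK'E) (galois_dim galKL).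
Qed.

End LinearlyDisjoint.

Section BasisDescent.

Variables (M : splittingFieldType rat) (K K' L E : {subfield M}).
Hypotheses (galKE : galois K E) (galKK' : galois K K') (galKL : galois K L).
Hypotheses (cap_K : (K' :&: L)%VS = K) (prod_E : (K' * L)%VS = E).

Let sKK' : (K <= K')%VS. Proof. by case/and3P: galKK'. Qed.
Let sKL : (K <= L)%VS. Proof. by case/and3P: galKL. Qed.
Let sK'E : (K' <= E)%VS. Proof. by rewrite -prod_E field_subvMr. Qed.
Let sLE : (L <= E)%VS. Proof. by rewrite -prod_E field_subvMl. Qed.

Definition ga_conj (d : gal_of E) (a : group_algebra K' E) :
    group_algebra K' E :=
  ga_of (fun g => d (vsval (a g))).

Section Conjugation.

Variable d : gal_of E.
Hypothesis Dd : d \in 'Gal(E / L)%g.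

Lemma ga_conjE a g : vsval (ga_conj d a g) = d (vsval (a g)).
Proof.
have sKK'E : (K <= K' <= E)%VS by rewrite sKK'.
have [_ _ nKK'] := and3P galKK'.
have Kd : d \in 'Gal(E / K)%g by apply: subsetP Dd; apply: galS.
by apply: ga_ofE;
  rewrite -(normalField_cast_eq sKK'E nKK' Kd (subvsP _)) memv_gal ?subvsP.
Qed.

Lemma ga_conj_act a t : t \in E -> ga_act (ga_conj d a) (d t) = d (ga_act a t).
Proof.
move=> Et; rewrite rmorph_sum; apply: eq_bigr => g _;
  rewrite ga_conjE rmorphM /=.
have cGD := disjoint_gal_cent galKK' galKL prod_E.
by rewrite -!galM // (centsP cGD _ (subgP g) _ Dd).
Qed.

Lemma associated_order_conj a :
  associated_order a -> associated_order (ga_conj d a).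
Proof.
move=> aA t [Et intt]; split; first exact: mem_ga_act.
have Edt : (d^-1)%g t \in E by rewrite memv_gal.
have -> : t = d ((d^-1)%g t) by rewrite -galM // mulVg gal_id.
rewrite ga_conj_act //; apply: integral_aut; apply: (proj2 (aA _ _)).
by split=> //; apply: integral_aut.
Qed.

End Conjugation.

Variables (n : nat) (e : 'I_n -> M).
Hypotheses (basis_e : integers_basis K' E e) (Le : forall i, e i \in L).

(* The coordinates are unique, hence invariant under ['Gal(E / L)]. *)
Lemma integers_basis_coef_mem (a : {ffun 'I_n -> group_algebra K' E}) y :
    ring_of_integers L y -> (forall i, associated_order (a i)) ->
    y = \sum_i ga_act (a i) (e i) ->
  forall i g, vsval (a i g) \in K.
Proof.
move=> [Ly inty] aA Dy i g; rewrite -cap_K memv_cap subvsP /=.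
have Ey := subvP sLE y Ly.
have galLE : galois L E by apply: galoisS galKE; rewrite sKL.
rewrite -(galois_fixedField galLE); apply/fixedFieldP => [|d Dd].
  exact: subvP sK'E _ (subvsP _).
have [b [_ uniq_b]] := proj2 basis_e y (conj Ey inty).
have /ffunP/(_ i) : a = [ffun j => ga_conj d (a j)].
  transitivity b; [exact/esym/uniq_b | apply: uniq_b; split=> [j|]].
    by rewrite ffunE; apply: (associated_order_conj Dd).
  rewrite -[LHS](fixed_gal sLE Dd Ly) Dy rmorph_sum; apply: eq_bigr => j _.
  by rewrite ffunE -[in RHS](fixed_gal sLE Dd (Le j)) ga_conj_act ?(subvP sLE).
by rewrite ffunE => /ffunP/(_ g)/(congr1 vsval) /=; rewrite ga_conjE.
Qed.

Theorem integers_basis_descent : integers_basis K L e.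
Proof.
have [r [l rK lK] rE] :=
  disjoint_gal_restriction galKE galKK' galKL cap_K prod_E.
split=> [i | y Oy]; first by split; [apply: Le | case: (proj1 basis_e i)].
have [Ly inty] := Oy; have Ey := subvP sLE y Ly.
have act_restr (c : group_algebra K L) t : t \in L ->
    let c_r : group_algebra K' E := ga_of (fun g => vsval (c (r g))) in
    ga_act c t = ga_act c_r t.
  move=> Lt c_r; rewrite ga_act_of => [|g];
    last exact: (subvP sKK' _ (subvsP _)).
  rewrite /ga_act (reindex r) /=; last by exists l => g _.
  by apply: eq_bigr => g _; rewrite rE.
have [a [[aA Dy] _]] := proj2 basis_e y (conj Ey inty).
have Ka := integers_basis_coef_mem Oy aA Dy.
pose b i : group_algebra K L := ga_of (fun h => vsval (a i (l h))).
have bE i t : t \in L -> ga_act (b i) t = ga_act (a i) t.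
  move=> Lt; rewrite act_restr //; congr (ga_act _ t); apply/ffunP=> g.
  by apply: subvs_inj; rewrite !ga_ofE ?rK // (subvP sKK').
exists [ffun i => b i]; split=> [|c [cA Dyc]].
  split=> [i t [Lt intt] | ]; last by rewrite {1}Dy; apply: eq_bigr => i _;
    rewrite ffunE bE.
  rewrite ffunE; split; first exact: mem_ga_act.
  by rewrite bE //; apply: (proj2 (aA i t _)); split; rewrite // (subvP sLE).
pose c' i : group_algebra K' E := ga_of (fun g => vsval (c i (r g))).
have eq_ac' : a =1 c'.
  apply: (integers_basis_inj sK'E basis_e); rewrite -Dy Dyc.
  by apply: eq_bigr => i _; apply: act_restr.
apply/ffunP=> i; apply/ffunP=> h; apply: subvs_inj;
  rewrite ffunE ga_ofE // eq_ac'.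
by rewrite ga_ofE ?lK // (subvP sKK') ?subvsP.
Qed.

End BasisDescent.

(** * Generators lying in a subfield *)

Lemma equivalence_representative (T : finType) (S : rel T) (good : pred T) :
    equivalence_rel S -> (forall x, exists2 y, S x y & good y) ->
  exists rho : T -> T,
    (forall x, S x (rho x) /\ good (rho x)) /\
      (forall x y, S x y -> rho x = rho y).
Proof.
move=> eqS ex_good; pose rho x := odflt x [pick y | S x y && good y].
have rhoP x : S x (rho x) /\ good (rho x).
  rewrite /rho; case: pickP => [y /andP[] // | none].
  by have [y Sxy gy] := ex_good x; have := none y; rewrite Sxy gy.
exists rho; split=> // x y Sxy.
have eq_good t : S x t && good t = S y t && good t by have [_ ->] := eqS x y t.
have [Sy gy] := rhoP y; rewrite /rho (eq_pick eq_good).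
by case: pickP => // /(_ (rho y)); rewrite Sy gy.
Qed.

Section StableTransversal.

Variables (aT : finGroupType) (A : {group aT}) (T : finType)
  (to : {action aT &-> T}).
Variable R : rel T.
Hypothesis R_equiv : equivalence_rel R.
Hypothesis R_to : {in A, forall a, {homo to^~ a : x y / R x y}}.

Definition orbit_rel : rel T := fun x y => [exists a in A, R x (to y a)].

Let R_sym x y : R x y -> R y x.
Proof. by case: (R_equiv x y x) => Rxx /[apply] <-. Qed.

Lemma orbit_rel_equiv : equivalence_rel orbit_rel.
Proof.
have refl x : orbit_rel x x.
  by apply/exists_inP; exists 1%g; rewrite ?group1 // act1;
    case: (R_equiv x x x).
have sym x y : orbit_rel x y -> orbit_rel y x.
  case/exists_inP=> a Aa Rxya; apply/exists_inP; exists a^-1%g;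
    rewrite ?groupV //.
  by apply: R_sym; rewrite -[y in R _ y](actK to a) R_to ?groupV.
have trans x y t : orbit_rel x y -> orbit_rel y t -> orbit_rel x t.
  case/exists_inP=> a Aa Rxya /exists_inP[b Ab Rytb]; apply/exists_inP.
  exists (b * a)%g; rewrite ?groupM // actM.
  by case: (R_equiv x (to y a) (to (to t b) a)) => _ -> //; apply: R_to.
by move=> x y t; split=> // Sxy; apply/idP/idP; apply: trans => //; apply: sym.
Qed.

(* In each class choose a point whose stabilizer is that of the class; the
   orbits of the chosen points form the transversal. *)
Lemma stable_transversal :
    (forall x, exists2 y,
       R x y & {in A, forall a, R y (to y a) -> to y a = y}) ->
  exists X : {set T},
    [/\ [acts A, on X | to]%g, forall x, exists2 y, y \in X & R x y
      & {in X &, forall x y, R x y -> x = y}].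
Proof.
move=> ex_fix; pose good y := [forall a in A, R y (to y a) ==> (to y a == y)].
have [x | rho [rhoP rho_eq]] :=
    equivalence_representative (good := good) orbit_rel_equiv.
  have [y Rxy fix_y] := ex_fix x; exists y.
    by apply/exists_inP; exists 1%g; rewrite ?group1 ?act1.
  by apply/forall_inP=> a Aa; apply/implyP=> Ryya; apply/eqP/fix_y.
pose X := [set to (rho x) a | x in T, a in A].
have Xto x a : x \in X -> a \in A -> to x a \in X.
  case/imset2P=> t b Tt Ab -> Aa; rewrite -actM.
  by apply/imset2P; exists t (b * a)%g; rewrite ?groupM.
exists X; split.
- apply/actsP=> a Aa x; apply/idP/idP=> [Xxa | /Xto->//].
  by rewrite -(actK to a x) Xto ?groupV.
- move=> x; have [/exists_inP[a Aa Rxa] _] := rhoP x.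
  by exists (to (rho x) a) => //; apply/imset2P; exists x a.
move=> _ _ /imset2P[x a _ Aa ->] /imset2P[y b _ Ab ->] Rab.
have Aba : (b * a^-1)%g \in A by rewrite groupM ?groupV.
have Rxy : R (rho x) (to (rho y) (b * a^-1)%g).
  by rewrite actM -[rho x](actK to a) R_to ?groupV.
have rho_xy : rho x = rho y.
  have rho_idem t : rho (rho t) = rho t by rewrite -(rho_eq t) //;
    case: (rhoP t).
  by rewrite -(rho_idem x) -(rho_idem y); apply/rho_eq/exists_inP;
    exists (b * a^-1)%g.
rewrite rho_xy in Rxy *; have [_ /forall_inP/(_ _ Aba)] := rhoP y.
by rewrite Rxy => /eqP fix_y; rewrite -[in LHS]fix_y -actM mulgKV.
Qed.

End StableTransversal.

Section ExponentAction.

Variables (M : splittingFieldType rat) (n : nat) (z : M).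
Hypothesis prim_z : n.-primitive_root z.

Local Notation E := <<1%AS; z>>%AS.
Let n_gt0 := prim_order_gt0 prim_z.

Definition gal_exponent (d : gal_of E) : nat := sval (aut_prim_rootP d prim_z).

Lemma gal_exponentE (d : gal_of E) : d z = z ^+ gal_exponent d.
Proof. by rewrite /gal_exponent; case: aut_prim_rootP. Qed.

Definition exponent_act (i : 'I_n) (d : gal_of E) : 'I_n :=
  Ordinal (ltn_pmod (gal_exponent d * i) n_gt0).

Lemma expr_exponent_act (i : 'I_n) (d : gal_of E) :
  z ^+ exponent_act i d = d (z ^+ i).
Proof. by rewrite /= (prim_expr_mod prim_z) exprM -gal_exponentE rmorphXn. Qed.

Lemma expr_prim_root_inj : injective (fun i : 'I_n => z ^+ i).
Proof.
move=> i j /eqP; rewrite (eq_prim_root_expr prim_z) !modn_small // => /eqP.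
exact: val_inj.
Qed.

Fact exponent_act1 : exponent_act^~ (1 : gal_of E)%g =1 id.
Proof. by move=> i; apply: expr_prim_root_inj;
  rewrite expr_exponent_act gal_id. Qed.

Fact exponent_actM i : act_morph exponent_act i.
Proof.
move=> d e; apply: expr_prim_root_inj; rewrite !expr_exponent_act.
by rewrite galM // rpredX ?memv_adjoin.
Qed.

Canonical exponent_action := TotalAction exponent_act1 exponent_actM.

End ExponentAction.

Lemma modn_fixed_multiplier p s m i : prime p ->
  (i = m * i %[mod p ^ s])%N -> ~~ (p ^ s %| i)%N -> (m = 1 %[mod p])%N.
Proof.
move=> p_pr; case: m => [|m] eq_mi ndv_i.
  by rewrite /dvdn eq_mi mod0n in ndv_i.
apply/eqP; rewrite eqn_mod_dvd // subSS subn0; apply: contraNT ndv_i => ndv_m.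
rewrite -(Gauss_dvdr (n := m)) ?coprimeXl ?prime_coprime //.
rewrite -[(m * i)%N](addKn i) -mulSn -eqn_mod_dvd; first by rewrite eq_mi.
exact: leq_pmull.
Qed.

Section SubfieldGenerator.

Variables (M : splittingFieldType rat) (p k s : nat) (z : M) (L : {subfield M}).
Hypotheses (p_pr : prime p) (prim_z : (p ^ k.+1 * p ^ s).-primitive_root z).

Local Notation F := <<1%AS; z>>%AS.
Local Notation K := <<1%AS; z ^+ (p ^ s)>>%AS.
Local Notation N := (p ^ k.+1 * p ^ s)%N.
Local Notation w := (z ^+ (p ^ k * p ^ s)).

Hypotheses (sLF : (L <= F)%VS) (sFLw : (F <= <<L; w>>)%VS).

Let p_gt0 := prime_gt0 p_pr.
Let N_gt0 := prim_order_gt0 prim_z.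

Let coprime_S c : coprime (p ^ k.+1) c -> coprime (p ^ s) c.
Proof. by rewrite coprime_pexpl // => /coprimeXl->. Qed.

Let exponent_act_mod (i : 'I_N) (d : gal_of F) :
  (exponent_act prim_z i d = gal_exponent prim_z d * i %[mod p ^ s])%N.
Proof. by rewrite /= modn_dvdm ?dvdn_mull. Qed.

Lemma gal_class_stabilizer_eq1 (d : gal_of F) (i : 'I_N) :
    d \in 'Gal(F / L)%g -> ~~ (p ^ s %| i)%N ->
  same_class (p ^ k.+1) (p ^ s) i (exponent_act prim_z i d) -> d = 1%g.
Proof.
move=> Ld ndv_i /(same_classP _ _ _ (_ : 0 < p ^ s)%N)[|t eq_it].
  by rewrite expn_gt0 p_gt0.
have act_mod := exponent_act_mod i d; set c := gal_exponent prim_z d in act_mod.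
have c1 : (c = 1 %[mod p])%N.
  have <- : ((1 + p ^ k.+1 * t) * c = 1 %[mod p])%N.
    apply: modn_fixed_multiplier p_pr _ ndv_i.
    by rewrite eq_it -mulnA -[LHS]modnMmr act_mod modnMmr.
  by rewrite mulnDl mul1n expnS -!mulnA addnC mulnC modnMDl.
apply: gal_eq1; apply: subv_trans sFLw _; apply/FadjoinP; split.
  by rewrite -galois_connection // sub1set.
apply/fixedFieldP=> [|_ /set1P->]; first by rewrite rpredX ?memv_adjoin.
rewrite rmorphXn /= (gal_exponentE prim_z) -/c -exprM; apply/eqP.
have := congr1 (muln^~ (p ^ k * p ^ s)%N) c1; rewrite /= !muln_modl mul1n.
by rewrite [(p * _)%N]mulnA -expnS (eq_prim_root_expr prim_z) => ->.
Qed.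

Lemma subfield_generator :
  exists2 x, x \in L & integers_basis K F (fun _ : 'I_1 => x).
Proof.
have S_gt0 : (0 < p ^ s)%N by rewrite expn_gt0 p_gt0.
pose R : rel 'I_N := fun i j => same_class (p ^ k.+1) (p ^ s) i j.
have [|||X [actX X_cover X_inj]] :=
    @stable_transversal _ 'Gal(F / L)%G _ (exponent_action prim_z) R.
- move=> i j l; exact: (same_class_equiv S_gt0 coprime_S).
- move=> d _ i j /(same_classMl S_gt0 (gal_exponent prim_z d)).
  by rewrite -(eq_same_class _ (exponent_act_mod i d) (exponent_act_mod j d)).
- move=> i; have [dvd_i | ndv_i] := boolP (p ^ s %| i)%N.
    exists (Ordinal N_gt0).
      by rewrite /R /same_class muln0 gcdn0 mod0n.
    by move=> d _ _; apply: val_inj; rewrite /= muln0 mod0n.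
  exists i; first by rewrite /R /same_class.
  by move=> d Ld /(gal_class_stabilizer_eq1 Ld ndv_i)->; apply: act1.
exists (\sum_(i in X) z ^+ i).
  have galLF : galois L F by apply: (galois_sub_cyclotomic prim_z).
  rewrite -(galois_fixedField galLF); apply/fixedFieldP=> [|d Ld].
    by apply: rpred_sum => i _; rewrite rpredX ?memv_adjoin.
  rewrite rmorph_sum [RHS](reindex_acts _ actX Ld).
  by apply: eq_bigr => i _; rewrite expr_exponent_act.
apply: (class_sum_basis prim_z coprime_S) => // [y [Fy inty] | j].
  apply: (@integral_cyclotomic_prime_power _ p (k + s)) Fy inty => //.
  by rewrite -addSn expnD.
have [i Xi Rji] := X_cover (Ordinal (ltn_pmod j N_gt0)); exists i => //.
by rewrite -(eq_same_class _ (i1 := j %% N) (j1 := i)) //= modn_dvdm ?dvdn_mull.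
Qed.

End SubfieldGenerator.

(** * Subfields of a cyclotomic field of odd prime power order *)

Lemma units_Zp_prime_power_cyclic p m :
  prime p -> odd p -> cyclic (units_Zp (p ^ m.+1)).
Proof.
move=> p_pr p_odd; set N := (p ^ m.+1)%N.
have N_gt1 : (1 < N)%N by rewrite -(exp1n m.+1) ltn_exp2r ?prime_gt1.
pose a : 'Z_N := Zp1; have oa : #[a]%g = N by rewrite order_Zp1 Zp_cast.
suff : cyclic (Aut <[a]>) by rewrite -(isog_cyclic (Zp_unit_isog a)) oa.
have p_cycle : (p.-group <[a]>)%g by rewrite /pgroup -orderE oa pnatX pnat_id.
have nt_cycle : (<[a]> != 1)%g by rewrite -cardG_gt1 -orderE oa.
have /= := cyclic_pgroup_Aut_structure p_cycle (cycle_cyclic a) nt_cycle.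
case=> expo [_ [_ cycF _ _]].
by case: ifP => [_ -> // | _ [t [_ _ _]]]; rewrite p_odd => -[[]].
Qed.

Lemma prime_power_primitive_root p m : prime p -> odd p ->
  exists2 g, coprime g (p ^ m.+1)
    & forall c, coprime c (p ^ m.+1) -> exists i, (c = g ^ i %[mod p ^ m.+1])%N.
Proof.
move=> p_pr p_odd; set N := (p ^ m.+1)%N.
have N_gt1 : (1 < N)%N by rewrite -(exp1n m.+1) ltn_exp2r ?prime_gt1.
have /cyclicP[u Du] := units_Zp_prime_power_cyclic m p_pr p_odd.
exists (val u) => [|c co_c];
  first by rewrite coprime_sym -unitZpE // natr_Zp (valP u).
have c_unit : (c%:R : 'Z_N) \is a GRing.unit by rewrite unitZpE // coprime_sym.
have /cycleP[i /(congr1 val)] : FinRing.unit 'Z_N c_unit \in <[u]>%g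
  by rewrite -Du inE.
rewrite /= FinRing.val_unitX => Dc; exists i.
by rewrite -!(val_Zp_nat N_gt1) natrX natr_Zp Dc.
Qed.

Lemma cyclic_gal_cyclotomic (M : splittingFieldType rat) p m (z : M) :
    prime p -> odd p -> (p ^ m.+1).-primitive_root z ->
  cyclic 'Gal(<<1%AS; z>>%AS / 1)%g.
Proof.
move=> p_pr p_odd prim_z.
have [c co_c gen_c] := prime_power_primitive_root m p_pr p_odd.
have [g _ gz] := gal_cyclotomic_exists prim_z co_c.
have expr_g i : (g ^+ i)%g z = z ^+ (c ^ i).
  elim: i => [|i IHi]; first by rewrite expg0 gal_id.
  by rewrite expgSr galM ?memv_adjoin // IHi rmorphXn /= gz -exprM expnS.
apply/cyclicP; exists g; apply/eqP; rewrite eqEsubset cycle_subG mem_gal1 andbT.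
apply/subsetP=> f _; have [d /gen_c[i Dd] fz] := aut_prim_rootP f prim_z.
apply/cycleP; exists i; apply: gal_cyclotomic_eq.
by rewrite expr_g [LHS]fz -(prim_expr_mod prim_z) Dd (prim_expr_mod prim_z).
Qed.

Lemma cyclic_galois_subfield_eq (F : fieldType) (M : splittingFieldType F)
    (K E A B : {subfield M}) :
    galois K E -> cyclic 'Gal(E / K)%g ->
    (K <= A <= E)%VS -> (K <= B <= E)%VS ->
  \dim A = \dim B -> A = B.
Proof.
move=> galKE cycG sKAE sKBE eq_dim.
have [galAE galBE] : galois A E /\ galois B E by split; apply: galoisS galKE.
have [[sKA _] [sKB _]] := (andP sKAE, andP sKBE).
have eqG : 'Gal(E / A)%g = 'Gal(E / B)%g.
  apply/eqP; rewrite (eq_subG_cyclic cycG) ?galS //.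
  by rewrite -!galois_dim // eq_dim.
by apply/val_inj;
  rewrite /= -(galois_fixedField galAE) eqG (galois_fixedField galBE).
Qed.

Section CyclotomicSubfields.

Variables (M : splittingFieldType rat) (p n : nat) (z : M).
Hypotheses (p_pr : prime p) (p_odd : odd p).
Hypothesis prim_z : (p ^ n.+1).-primitive_root z.

Local Notation E := <<1%AS; z>>%AS.
Local Notation Ea a := <<1%AS; z ^+ (p ^ a)>>%AS.

Let p_gt0 := prime_gt0 p_pr.

Lemma prim_root_exp_prime a :
  (a <= n)%N -> (p ^ (n - a).+1).-primitive_root (z ^+ (p ^ a)).
Proof.
move=> lean; have -> : (p ^ a = p ^ n.+1 %/ p ^ (n - a).+1)%N.
  by rewrite -subSn // -expnB ?subKn ?leq_subr // ltnW.
by apply: dvdn_prim_root => //; rewrite dvdn_exp2l // ltnS leq_subr.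
Qed.

Lemma dim_cyclotomic_prime_power a : (a <= n)%N ->
  \dim (Ea a) = (p.-1 * p ^ (n - a))%N.
Proof.
by move=> lean;
  rewrite (dim_cyclotomic (prim_root_exp_prime lean)) totient_pfactor.
Qed.

Lemma sub_cyclotomic_prime_power (A : {subfield M}) :
  z ^+ (p ^ n) \in A -> (A <= E)%VS -> exists2 a, (a <= n)%N & A = Ea a.
Proof.
move=> Az sAE; have p1_gt0 : (0 < p.-1)%N by rewrite -ltnS prednK ?prime_gt1.
have [m lemn DA] : exists2 m, (m <= n)%N & \dim A = (p.-1 * p ^ m)%N.
  have sEnA : (Ea n <= A)%VS by apply/FadjoinP; rewrite sub1v.
  have := field_dimS sAE; have := field_dimS sEnA.
  rewrite dim_cyclotomic_prime_power // subnn muln1 => /dvdnP[e ->].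
  rewrite mulnC -[z in <<_; z>>%AS]expr1 -(expn0 p)
    dim_cyclotomic_prime_power // subn0.
  rewrite dvdn_pmul2l // => /(dvdn_pfactor _ _ p_pr)[m lemn ->].
  by exists m.
exists (n - m)%N; first exact: leq_subr.
have sEE a : (1 <= Ea a <= E)%VS.
  by rewrite sub1v; apply/FadjoinP; rewrite sub1v rpredX ?memv_adjoin.
apply: cyclic_galois_subfield_eq (galois_cyclotomic prim_z) _ _ (sEE _) _.
- exact: cyclic_gal_cyclotomic prim_z.
- by rewrite sub1v.
by rewrite DA dim_cyclotomic_prime_power ?leq_subr // subKn.
Qed.

End CyclotomicSubfields.

Lemma cyclotomic_subfield_generator (M : splittingFieldType rat) p n s (z : M)
    (K L F : {subfield M}) :
    prime p -> odd p -> (p ^ n.+1).-primitive_root z -> z ^+ (p ^ n) \in K ->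
    (K <= F)%VS -> (F <= <<1; z>>)%VS -> \dim_K F = (p ^ s)%N ->
    (L <= F)%VS -> (F <= <<L; z ^+ (p ^ n)>>)%VS ->
  exists2 x, x \in L & integers_basis K F (fun _ : 'I_1 => x).
Proof.
move=> p_pr p_odd prim_z Kw sKF sFE dim_KF sLF sFLw.
have [a lean DF] :=
  sub_cyclotomic_prime_power p_pr p_odd prim_z (subvP sKF _ Kw) sFE.
set y := z ^+ (p ^ a) in DF; set m := (n - a)%N.
have prim_y : (p ^ m.+1).-primitive_root y :=
  prim_root_exp_prime p_pr prim_z lean.
have Dw : y ^+ (p ^ m) = z ^+ (p ^ n) by rewrite -exprM -expnD subnKC.
rewrite {F}DF -Dw in Kw sKF dim_KF sLF sFLw sFE *.
have [b lebm DK] := sub_cyclotomic_prime_power p_pr p_odd prim_y Kw sKF.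
have Ds : b = s.
  have := dim_sup_field sKF; rewrite dim_KF DK (dim_cyclotomic prim_y).
  rewrite (dim_cyclotomic_prime_power p_pr prim_y lebm) totient_pfactor //=
    mulnCA.
  move/eqP; rewrite eqn_pmul2l ?(prime_gt1 p_pr) -?expnD; last first.
    by rewrite -ltnS prednK ?prime_gt0 ?prime_gt1.
  by rewrite eqn_exp2l ?prime_gt1 // => /eqP; lia.
rewrite {b}Ds in lebm DK; rewrite DK.
have Dm : (p ^ m = p ^ (m - s) * p ^ s)%N by rewrite -expnD subnK.
apply: (@subfield_generator _ p (m - s)) => //; last by rewrite -Dm.
by rewrite -expnD addSn subnK.
Qed.

Lemma coprime_adjoin_prime_root (M : splittingFieldType rat) (p : nat) (w : M)
    (K : {subfield M}) :
  prime p -> p.-primitive_root w -> coprime p (\dim_K <<K; w>>).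
Proof.
move=> p_pr prim_w; rewrite -adjoin_degreeE prime_coprime // gtnNdvd //.
have : (size (minPoly K w) <= size (minPoly 1 w))%N.
  exact: dvdp_leq (monic_neq0 (monic_minPoly 1 w)) (minPolyS w (sub1v K)).
rewrite !size_minPoly ltnS => /leq_ltn_trans; apply.
have := dim_cyclotomic prim_w; rewrite dim_Fadjoin dimv1 muln1 => ->.
by rewrite totient_prime // prednK ?prime_gt0.
Qed.

Lemma capv_coprime_dim (F : fieldType) (M : fieldExtType F)
  (K A B : {subfield M}) :
    (K <= A)%VS -> (K <= B)%VS -> coprime (\dim_K A) (\dim_K B) ->
  (A :&: B)%VS = K.
Proof.
move=> sKA sKB co_AB; have sKAB : (K <= A :&: B)%VS by rewrite subv_cap sKA.
have dim_dvd (C : {subfield M}) :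
  (A :&: B <= C)%VS -> (\dim_K (A :&: B) %| \dim_K C)%N.
  move=> sABC; rewrite -(dvdn_pmul2r (adim_gt0 K)).
  by rewrite -!dim_sup_field ?(field_dimS sABC) // (subv_trans sKAB).
have /eqP dim1 : \dim_K (A :&: B) == 1%N.
  by rewrite -dvdn1 -(eqP co_AB) dvdn_gcd !dim_dvd ?capvSl ?capvSr.
by apply/eqP; rewrite eq_sym eqEdim sKAB (dim_sup_field sKAB) dim1 mul1n /=.
Qed.

Lemma prodv_adjoin (F : fieldType) (M : fieldExtType F) (K L : {subfield M})
    (w : M) :
  (K <= L)%VS -> (<<K; w>> * L)%VS = <<L; w>>%VS.
Proof.
move=> sKL; apply/eqP; rewrite eqEsubv; apply/andP; split.
  rewrite prodv_sub ?subv_adjoin //; apply/FadjoinP; rewrite memv_adjoin.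
  by split=> //; apply: subv_trans (subv_adjoin L w).
apply/(FadjoinP (E := (<<K; w>> * L)%AS)); split; first exact: field_subvMl.
exact: subvP (field_subvMr _ _) _ (memv_adjoin K w).
Qed.

Theorem theorem1p2 (p r s : nat) (M : splittingFieldType rat) (zeta : M)
    (K L : {subfield M})
    (p_prime : prime p) (p_odd : odd p) (r_ge1 : (1 <= r)%N) (s_ge1 : (1 <= s)%N)
    (zeta_prim : (p ^ (r + s))%N.-primitive_root zeta)
    (sub_KL : (K <= L)%VS) (deg_KL : \dim_K L = (p ^ s)%N)
    (sub_L_cyclo : (L <= <<1%VS; zeta>>)%VS) :
  leopoldt K L.
Proof.
case: r r_ge1 zeta_prim => // r _; rewrite addSn => zeta_prim.
set n := (r + s)%N in zeta_prim; pose w := zeta ^+ (p ^ n).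
have Ew : w \in <<1%AS; zeta>>%AS by rewrite rpredX ?memv_adjoin.
have sLwE : (<<L; w>> <= <<1%AS; zeta>>)%VS by apply/FadjoinP.
have sKwE : (<<K; w>> <= <<1%AS; zeta>>)%VS.
  by apply/FadjoinP; split=> //; apply: subv_trans sub_L_cyclo.
have prim_w : p.-primitive_root w.
  by have := prim_root_exp_prime p_prime zeta_prim (leqnn n);
    rewrite subnn expn1.
have sKLw : (K <= <<L; w>>)%VS := subv_trans sub_KL (subv_adjoin L w).
have [galKLw galKKw galKL] :
  [/\ galois K <<L; w>>, galois K <<K; w>> & galois K L].
  by split; apply: (galois_sub_cyclotomic zeta_prim); rewrite ?subv_adjoin.
have prod_Lw := prodv_adjoin w sub_KL.
have cap_K : (<<K; w>> :&: L)%VS = K.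
  apply: capv_coprime_dim; rewrite ?subv_adjoin // deg_KL coprime_sym.
  by rewrite coprimeXl ?coprime_adjoin_prime_root.
suff [x Lx basis_x] : exists2 x, x \in L &
    integers_basis <<K; w>>%AS <<L; w>>%AS (fun _ : 'I_1 => x).
  by exists 1%N, (fun=> x); apply: (integers_basis_descent galKLw galKKw galKL).
apply: (cyclotomic_subfield_generator (s := s) p_prime p_odd zeta_prim) => //.
- exact: memv_adjoin.
- by apply/FadjoinP; rewrite memv_adjoin sKLw.
- by rewrite (disjoint_dim galKLw galKKw galKL cap_K prod_Lw).
exact: subv_adjoin.
Qed.
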